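(* Let $(X,T)$ be a dynamical system with the shadowing property and let $Y\subseteq X$ be a chain recurrent class. If $\Phi\in\mathcal{C}(X,\mathbb{R})$ is such that $I_\Phi(T)\cap Y\neq\emptyset$, then $h_{\mathrm{top}}(T,I_\Phi(T))\geq h_{\mathrm{top}}(T,Y)$.
   Context: A dynamical system $(X,T)$ is a compact metric space $(X,d)$ together with a continuous map $T:X\to X$. $\mathcal{C}(X,\mathbb{R})$ is the set of continuous functions $X\to\mathbb{R}$. For $\delta>0$, a sequence $\{x_n\}_{n\ge 0}\subseteq X$ is a $\delta$-pseudo-orbit if $d(Tx_n,x_{n+1})<\delta$ for all $n\geq 0$; a finite one $\{x_i\}_{i=0}^k$, with $k\ge1$, is a $\delta$-chain from $x_0$ to $x_k$. $(X,T)$ has the shadowing property if for every $\varepsilon>0$ there is $\delta>0$ such that for every $\delta$-pseudo-orbit $\{x_n\}_{n\ge 0}$ there is $y\in X$ with $d(T^ny,x_n)<\varepsilon$ for all $n\geq 0$. Points $x,y\in X$ are chain related if for every $\varepsilon>0$ there are an $\varepsilon$-chain from $x$ to $y$ and an $\varepsilon$-chain from $y$ to $x$. A point is chain recurrent if it is chain related to itself. Chain relatedness is an equivalence relation on the set $CR(X)$ of chain recurrent points, and its equivalence classes are the chain recurrent classes; each is closed and satisfies $T(Y)\subseteq Y$. The $\Phi$-irregular set $I_\Phi(T)$ is the set of $x\in X$ for which $\lim_{n\to\infty}\frac1n\sum_{i=0}^{n-1}\Phi(T^ix)$ does not exist. $h_{\mathrm{top}}(T,E)$ is the Bowen topological entropy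 of a (not necessarily compact or invariant) set $E\subseteq X$: let $B_n(x,\varepsilon)=\{y\in X:\max_{0\le j\le n-1}d(T^jx,T^jy)<\varepsilon\}$; let $\mathcal{G}_n(E,\varepsilon)$ be the collection of all finite or countable coverings of $E$ by balls $B_v(x,\varepsilon)$ with $v\geq n$; put $C(E;t,n,\varepsilon,T)=\inf_{C\in\mathcal{G}_n(E,\varepsilon)}\sum_{B_v(x,\varepsilon)\in C}e^{-tv}$, $C(E;t,\varepsilon,T)=\lim_{n\to\infty}C(E;t,n,\varepsilon,T)$, $h_{\mathrm{top}}(E,\varepsilon,T)=\inf\{t:C(E;t,\varepsilon,T)=0\}$ and $h_{\mathrm{top}}(T,E)=\lim_{\varepsilon\to0}h_{\mathrm{top}}(E,\varepsilon,T)$. *)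

(* Defs.v *)
From mathcomp Require Import all_boot all_order all_algebra.
From mathcomp Require Import all_classical all_reals all_analysis.

Set Implicit Arguments.
Unset Strict Implicit.
Unset Printing Implicit Defensive.

Import Order.TTheory GRing.Theory Num.Theory.
Import numFieldNormedType.Exports.

Local Open Scope classical_set_scope.
Local Open Scope ring_scope.

Definition pseudo_orbit (R : realType) (X : metricType R) (T : X -> X)
    (delta : R) (x : nat -> X) : Prop :=
  forall n : nat, mdist (T (x n)) (x n.+1) < delta.

Definition shadowing (R : realType) (X : metricType R) (T : X -> X) : Prop :=
  forall eps : R, 0 < eps ->
  exists2 delta : R, 0 < delta &
    forall x : nat -> X, pseudo_orbit T delta x ->
    exists y : X, forall n : nat, mdist (iter n T y) (x n) < eps.

(* The chain is x 0, ..., x k; the values of x beyond k are irrelevant. *)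
Definition chain_from_to (R : realType) (X : metricType R) (T : X -> X)
    (delta : R) (a b : X) : Prop :=
  exists (k : nat) (x : nat -> X),
    [/\ (1 <= k)%N, x 0%N = a, x k = b &
        forall i : nat, (i < k)%N -> mdist (T (x i)) (x i.+1) < delta].

Definition chain_related (R : realType) (X : metricType R) (T : X -> X)
    (x y : X) : Prop :=
  forall eps : R, 0 < eps ->
    chain_from_to T eps x y /\ chain_from_to T eps y x.

Definition chain_recurrent (R : realType) (X : metricType R) (T : X -> X) :
    set X :=
  [set x | chain_related T x x].

Definition chain_recurrent_class (R : realType) (X : metricType R)
    (T : X -> X) (Y : set X) : Prop :=
  exists2 x : X, chain_recurrent T x &
    Y = [set y | chain_recurrent T y /\ chain_related T x y].

(* The term at n = 0 is 0 by the convention 0^-1 = 0. *)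
Definition birkhoff_average (R : realType) (X : metricType R) (T : X -> X)
    (Phi : X -> R) (x : X) (n : nat) : R :=
  n%:R^-1 * \sum_(0 <= i < n) Phi (iter i T x).

Definition irregular_set (R : realType) (X : metricType R) (T : X -> X)
    (Phi : X -> R) : set X :=
  [set x | ~ cvg (birkhoff_average T Phi x n @[n --> \oo])].

(* Distances are nonnegative, so 0 is a neutral base value for the maximum;
   for n = 0 and eps > 0 the ball is the whole space. *)
Definition bowen_ball (R : realType) (X : metricType R) (T : X -> X)
    (n : nat) (x : X) (eps : R) : set X :=
  [set y | \big[Num.max/0]_(0 <= j < n) mdist (iter j T x) (iter j T y) < eps].

(* A covering by Bowen balls is recorded by its set of (center, length) pairs:
   (x, v) stands for the ball B_v(x, eps). *)
Definition bowen_covering (R : realType) (X : metricType R) (T : X -> X)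
    (E : set X) (n : nat) (eps : R) : set (set (X * nat)) :=
  [set C | [/\ countable C,
               (forall p, C p -> (n <= p.2)%N) &
               E `<=` \bigcup_(p in C) bowen_ball T p.2 p.1 eps]].

Definition bowen_pre (R : realType) (X : metricType R) (T : X -> X)
    (E : set X) (t : R) (n : nat) (eps : R) : \bar R :=
  ereal_inf [set \esum_(p in C) (expR (- t * p.2%:R))%:E
            | C in bowen_covering T E n eps].

(* This limit exists: bowen_pre is nondecreasing in n. *)
Definition bowen_outer (R : realType) (X : metricType R) (T : X -> X)
    (E : set X) (t eps : R) : \bar R :=
  lim (bowen_pre T E t n eps @[n --> \oo]).

Definition htop_eps (R : realType) (X : metricType R) (T : X -> X)
    (E : set X) (eps : R) : \bar R :=
  ereal_inf [set t%:E | t in [set t : R | bowen_outer T E t eps = 0%E]].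

(* This limit exists: htop_eps is nonincreasing in eps. *)
Definition htop (R : realType) (X : metricType R) (T : X -> X)
    (E : set X) : \bar R :=
  lim (htop_eps T E eps @[eps --> 0^'+]).

(* Main.v *)
Require Import Defs.
From mathcomp Require Import all_boot all_order all_algebra.
From mathcomp Require Import all_classical all_reals all_analysis.
From mathcomp Require Import zify ring lra.
Import Order.TTheory GRing.Theory Num.Theory.
Import numFieldNormedType.Exports.
Local Open Scope classical_set_scope.
Local Open Scope ring_scope.
Set Implicit Arguments.
Unset Strict Implicit.

(** The class [Y] has many orbit pieces, and the irregular point [b] of [Y]
    makes Birkhoff averages oscillate; shadowing combines both.

    If [t1 < htop_eps T Y eps], covering sums at exponent [t1] are bounded below,
    so a greedy choice gives about [expR (t1 * n)] points of [Y] whose orbit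
    pieces of length [n] are [eps]-separated ([greedy_separated]). All points of
    [Y] are chain related to [b], with chains of bounded length by compactness,
    so these pieces close up to pseudo-orbit loops at [b]; up to a bounded factor
    in their number, the loops have one common length and remain separated
    ([separated_loops]). Loops at [b] can be concatenated freely.

    Since the averages of [b] do not converge, long pieces of its own orbit close
    up to two loops of equal lengths whose averages differ by some [gamma]
    independent of the precision ([oscillating_loops]). Insert one of them, as a
    tail taking a small fixed proportion of the time, after each separated loop.
    For every sequence of separated loops, either the pseudo-orbit with constant
    tails is shadowed by an irregular point, or its averages nearly converge and
    then those of the pseudo-orbit with tails switched along geometrically growing
    stages oscillate ([staged_irregular]). Thus the irregular set contains a
    point for each sequence over an alphabet of nearly [expR (t1 * L)] letters,
    [L] being the block length, and points shadowing different letters in a block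
    separate during that block.

    Such a coded set has entropy at least any [t < t1] ([coding_le_htop_eps]): a
    ball of length [v] determines [v %/ L] letters, and a countable cover by
    cylinders has total uniform mass at least 1, which is the countable
    subadditivity of Lebesgue measure once sequences of letters are read as
    digits ([sum_cylinder_ge1]). *)

(** * Bowen entropy through covering sums *)

Section bowen_entropy.
Context {R : realType} {X : metricType R} (T : X -> X).
Implicit Types (E : set X) (t eps : R) (x y : X).

Lemma bowen_ballP n x eps y : 0 < eps ->
  bowen_ball T n x eps y <->
  forall j, (j < n)%N -> mdist (iter j T x) (iter j T y) < eps.
Proof.
move=> e0; rewrite /bowen_ball /= big_mkord; split=> [/bigmax_ltP[_ h] j jn|h].
  exact: (h (Ordinal jn)).
by apply/bigmax_ltP; split=> // i _; exact: h.
Qed.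

Lemma bowen_pre_nondecreasing E t eps :
  {homo (fun n => bowen_pre T E t n eps) : m n / (m <= n)%N >-> (m <= n)%E}.
Proof.
move=> m n mn; apply: ereal_inf_le_tmp => _ [C [cC lenC EC] <-].
by exists C => //; split=> // p /lenC; exact: leq_trans.
Qed.

Lemma bowen_outerE E t eps :
  bowen_outer T E t eps = ereal_sup (range (fun n => bowen_pre T E t n eps)).
Proof.
apply/cvg_lim => //; apply: ereal_nondecreasing_cvgn.
exact: bowen_pre_nondecreasing.
Qed.

Lemma expR_mul_nat_ge0 t (p : X * nat) : (0 <= (expR (- t * p.2%:R))%:E)%E.
Proof. by rewrite lee_fin expR_ge0. Qed.

Lemma bowen_pre_ge0 E t n eps : (0 <= bowen_pre T E t n eps)%E.
Proof.
by apply: le_ereal_inf_tmp => _ [C _ <-]; apply: esum_ge0 => p _; exact: expR_mul_nat_ge0.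
Qed.

Lemma bowen_pre_nonincreasing E s t n eps : s <= t ->
  (bowen_pre T E t n eps <= bowen_pre T E s n eps)%E.
Proof.
move=> st; apply: le_ereal_inf_tmp => _ [C CE <-].
apply: le_trans (ereal_inf_lbound _) _; first by exists C; [exact: CE|reflexivity].
apply: le_esum => p _; rewrite lee_fin ler_expR.
by rewrite ler_wpM2r// lerN2.
Qed.

Lemma htop_eps_nonincreasing E (eps1 eps2 : R) : 0 < eps1 -> eps1 <= eps2 ->
  (htop_eps T E eps2 <= htop_eps T E eps1)%E.
Proof.
move=> e0 e12; apply: ereal_inf_le_tmp => _ [t /= out0 <-].
exists t => //=; apply/eqP; rewrite eq_le; apply/andP; split; last first.
  rewrite bowen_outerE; apply: le_trans (bowen_pre_ge0 E t 0 eps2) _.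
  by apply: ereal_sup_ubound; exists 0%N.
rewrite -out0 !bowen_outerE; apply: ge_ereal_sup => _ [n _ <-].
apply: (@le_trans _ _ (bowen_pre T E t n eps1)); last by apply: ereal_sup_ubound; exists n.
apply: ereal_inf_le_tmp => _ [C [cC lenC EC] <-].
exists C => //; split=> // x /EC[p Cp xp]; exists p => //.
by apply: lt_le_trans e12.
Qed.

Lemma htopE E :
  htop T E = ereal_sup [set htop_eps T E eps | eps in [set eps | 0 < eps]].
Proof.
have -> : [set eps : R | 0 < eps] = [set` `]0, +oo[].
  by apply/seteqP; split=> x /=; rewrite in_itv/= andbT.
apply/cvg_lim => //; apply: nonincreasing_at_right_cvge => //.
move=> x y; rewrite !in_itv/= !andbT => x0 y0 xy.
exact: htop_eps_nonincreasing.
Qed.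

(** A positive lower bound on the covering sums at exponent [t] persists at
    every smaller exponent, so no exponent below [t] can annihilate the outer
    measure. *)
Lemma le_htop_eps E t eps c : 0 < c ->
  (forall n, (c%:E <= bowen_pre T E t n eps)%E) -> (t%:E <= htop_eps T E eps)%E.
Proof.
move=> c0 pre_ge; apply: le_ereal_inf_tmp => _ [s /= out0 <-].
rewrite lee_fin leNgt; apply/negP => st.
suff : (c%:E <= 0)%E by rewrite lee_fin leNgt c0.
rewrite -out0 bowen_outerE; apply: le_trans (ereal_sup_ubound _); last by exists 0%N.
exact: le_trans (pre_ge 0%N) (bowen_pre_nonincreasing _ _ _ (ltW st)).
Qed.

(** The outer measure is the supremum of the covering sums, so it can only be
    positive if they are eventually bounded away from 0. *)
Lemma lt_htop_eps E t eps : (t%:E < htop_eps T E eps)%E ->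
  exists c n0, 0 < c /\
    forall n, (n0 <= n)%N -> (c%:E <= bowen_pre T E t n eps)%E.
Proof.
move=> lt_t.
have : (0 < bowen_outer T E t eps)%E.
  rewrite lt_neqAle; apply/andP; split.
    apply/eqP => out0; move: lt_t; rewrite ltNge => /negP; apply.
    by apply: ereal_inf_lbound; exists t.
  rewrite bowen_outerE; apply: le_trans (bowen_pre_ge0 E t 0 eps) _.
  by apply: ereal_sup_ubound; exists 0%N.
rewrite bowen_outerE => /ereal_sup_gt[_ [n0 _ <-]] pre0.
have [c c0 cpre] : exists2 c, 0 < c & (c%:E <= bowen_pre T E t n0 eps)%E.
  case: (bowen_pre T E t n0 eps) pre0 => [r| |]//.
    by rewrite lte_fin => r0; exists r.
  by move=> _; exists 1; rewrite ?ltr01// leey.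
exists c, n0; split=> // n /(bowen_pre_nondecreasing E t eps).
exact: le_trans.
Qed.

Lemma htop_eps_ge0 E eps : E !=set0 -> (0 <= htop_eps T E eps)%E.
Proof.
move=> [x Ex]; apply: (@le_htop_eps _ 0 _ 1) => // n.
apply: le_ereal_inf_tmp => _ [C [_ _ EC] <-].
have [p Cp _] := EC _ Ex.
apply: esum_ge; exists [set p]; first by split => // q ->.
by rewrite fsbig_set1 oppr0 mul0r expR0.
Qed.

(** The greedy choice of points of [E] outside the balls already chosen can
    only stop once these balls cover [E], that is, not before the covering sum
    of the chosen balls reaches the lower bound [c]. *)
Lemma greedy_separated E t eps c n :
  (c%:E <= bowen_pre T E t n eps)%E ->
  forall k, k%:R * expR (- t * n%:R) < c -> exists s : nat -> X,
    (forall i, (i <= k)%N -> E (s i)) /\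
    (forall i j, (i < j)%N -> (j <= k)%N -> ~ bowen_ball T n (s i) eps (s j)).
Proof.
move=> pre_ge.
(* As long as the chosen balls are too few to cover [E], a new point exists. *)
have step (s : nat -> X) k : k%:R * expR (- t * n%:R) < c ->
    exists2 y, E y & forall i, (i < k)%N -> ~ bowen_ball T n (s i) eps y.
  move=> kc; apply: contrapT => /forall2NP noy.
  pose C : set (X * nat) := [set (s i, n) | i in `I_k].
  have finC : finite_set C by apply: finite_image; exact: finite_II.
  have covC : bowen_covering T E n eps C.
    split; first exact: finite_set_countable.
      by move=> _ [i _ <-].
    move=> y Ey; have [//|/existsNP[i /not_implyP[ik /contrapT yi]]] := noy y.
    by exists (s i, n) => //; exists i.
  have : (c%:E <= \esum_(p in C) (expR (- t * p.2%:R))%:E)%E.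
    apply: le_trans pre_ge _; apply: ereal_inf_lbound; by exists C.
  apply/negP; rewrite -ltNge.
  apply: le_lt_trans (_ : ((k%:R * expR (- t * n%:R))%:E < _)%E); last first.
    by rewrite lte_fin.
  rewrite esum_fset//.
  pose r := undup [seq (s i, n) | i <- iota 0 k].
  have -> : C = [set` r].
    apply/seteqP; split=> [_ [i ik <-]|p /=]; rewrite ?mem_undup.
      by rewrite /= mem_undup; apply/mapP; exists i; rewrite // mem_iota.
    by move=> /mapP[i]; rewrite mem_iota => ik ->; exists i.
  rewrite -fsbig_seq ?undup_uniq// sumEFin lee_fin.
  have -> : \sum_(p <- r) expR (- t * p.2%:R) = (size r)%:R * expR (- t * n%:R).
    rewrite (@eq_big_seq _ _ _ _ _ _ (fun=> expR (- t * n%:R))); last first.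
      by move=> p; rewrite mem_undup => /mapP[i _ ->].
    by rewrite big_const_seq count_predT iter_addr_0 mulr_natl.
  rewrite ler_wpM2r ?expR_ge0// ler_nat (leq_trans (size_undup _))//.
  by rewrite size_map size_iota.
elim=> [|k IH] kc.
  have [y Ey] : E !=set0.
    apply/set0P/negP => /eqP E0.
    move: kc; rewrite mul0r ltNge -lee_fin (le_trans pre_ge)//.
    apply: ereal_inf_lbound; exists set0; last by rewrite esum_set0.
    by split=> //; rewrite E0; exact: sub0set.
  exists (fun=> y); split=> // i j ij; rewrite leqn0 => /eqP j0.
  by move: ij; rewrite j0.
have [|s [sE sep]] := IH.
  by apply: le_lt_trans kc; rewrite ler_wpM2r ?expR_ge0// ler_nat.
have [y Ey ysep] := step s k.+1 kc.
exists (fun i => if (i <= k)%N then s i else y); split=> [i _|i j ij jk].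
  by case: ifPn => // ik; exact: sE.
have ik : (i <= k)%N by rewrite -ltnS (leq_trans ij).
rewrite ik; case: ifPn => jk'; first exact: sep.
exact: ysep.
Qed.

End bowen_entropy.

(** * Mass distribution on sequences of letters *)

Section digits.
Context {R : realType} (N : nat) (N_gt0 : (0 < N)%N).
Implicit Types (x : R) (k l : nat).

Definition digit x k : nat := (Num.truncn (N%:R ^+ k.+1 * x) %% N)%N.

Lemma truncnM_divn x : 0 <= x ->
  (Num.truncn (N%:R * x) %/ N)%N = Num.truncn x.
Proof.
move=> x0; have Nx0 : 0 <= N%:R * x by rewrite mulr_ge0.
have N0 : 0 < N%:R :> R by rewrite ltr0n.
have /andP[le_x lt_x] := truncn_itv x0.
apply/eqP; rewrite eqn_leq -ltnS ltn_divLR// leq_divRL//; apply/andP; split.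
  by rewrite truncn_lt_nat// natrM mulrC ltr_pM2r.
by rewrite truncn_ge_nat// natrM mulrC ler_pM2l.
Qed.

(** The integer part of [N ^ l * x] is the number written by the first [l]
    digits of [x]. *)
Lemma truncn_eq_digit l x x' : 0 <= x < 1 -> 0 <= x' < 1 ->
  (forall k, (k < l)%N -> digit x k = digit x' k) ->
  Num.truncn (N%:R ^+ l * x) = Num.truncn (N%:R ^+ l * x').
Proof.
move=> /andP[x0 x1] /andP[x'0 x'1]; elim: l => [_|l IH eq_d].
  by rewrite expr0 !mul1r !(@truncn_def _ _ 0%N)// ?x0 ?x1 ?x'0 ?x'1.
rewrite (divn_eq (Num.truncn (_ * x)) N) (divn_eq (Num.truncn (_ * x')) N).
have := eq_d l (leqnn _); rewrite /digit => ->.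
rewrite !exprS -!mulrA !truncnM_divn ?mulr_ge0 ?exprn_ge0//.
by rewrite IH// => k kl; apply: eq_d; rewrite ltnS ltnW.
Qed.

(** Reading [omega] as the sequence of base-[N] digits of a number of the unit
    interval, a set of sequences sharing their first [l] letters lies in an
    interval of length [N^-l]; countable subadditivity of Lebesgue measure then
    bounds the total length below by that of the unit interval. *)
Lemma sum_cylinder_ge1 (I : choiceType) (C : set I) (l : I -> nat)
    (U : I -> set (nat -> nat)) :
  countable C ->
  (forall w : nat -> nat, (forall k, (w k < N)%N) -> exists2 i, C i & U i w) ->
  (forall i w w', C i -> U i w -> U i w' ->
    forall k, (k < l i)%N -> w k = w' k) ->
  (1 <= \esum_(i in C) (N%:R ^- l i : R)%:E)%E.
Proof.
move=> /countable_injP[f f_inj] covU shareU.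
have N0 : 0 < N%:R :> R by rewrite ltr0n.
(* [n i] is the integer written by the common first letters of [U i]; any
   value does when no number of the unit interval has its digits in [U i]. *)
have /choice[n nE] : forall i, exists n, forall x, C i -> 0 <= x < 1 ->
    U i (digit x) -> Num.truncn (N%:R ^+ l i * x) = n.
  move=> i.
  have [[x [Ci x01 Ux]]|nox] :=
      pselect (exists x : R, [/\ C i, 0 <= x < 1 & U i (digit x)]).
    exists (Num.truncn (N%:R ^+ l i * x)) => x' _ x'01 Ux'.
    by apply: truncn_eq_digit => // k; exact: (shareU _ _ _ Ci).
  by exists 0%N => x Ci x01 Ux; case: nox; exists x.
pose J i : set R :=
  [set` `[(n i)%:R / N%:R ^+ l i, (n i).+1%:R / N%:R ^+ l i[].
have muJ i : lebesgue_measure (J i) = (N%:R ^- l i : R)%:E.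
  rewrite lebesgue_measure_itv/= lte_fin ltr_pM2r ?invr_gt0 ?exprn_gt0//.
  by rewrite ltr_nat ltnSn -EFinB -mulrBl -natr1 addrAC subrr add0r mul1r.
(* The intervals, reindexed by natural numbers along [f]; [F k] is empty when
   [k] is not in the image of [C]. *)
pose F k := \bigcup_(i in C `&` f @^-1` [set k]) J i.
have Ff i : C i -> F (f i) = J i.
  move=> Ci; rewrite /F (_ : _ `&` _ = [set i]) ?bigcup_set1//.
  apply/seteqP; split=> [j [Cj /= fji]|j ->]//.
  by apply: f_inj => //; rewrite inE.
have F0 k : ~ (f @` C) k -> F k = set0.
  move=> nk; rewrite /F bigcup0// => i [Ci fi]; case: nk; by exists i.
have mF k : measurable (F k).
  have [[i Ci <-]|/F0 ->] := pselect ((f @` C) k); last exact: measurable0.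
  by rewrite Ff//; exact: measurable_itv.
have cov : [set` `[0, 1[] `<=` \bigcup_k F k.
  move=> x /=; rewrite in_itv/= => x01.
  have [|i Ci Ui] := covU (digit x); first by move=> k; rewrite /digit ltn_mod.
  exists (f i) => //; rewrite Ff// /J /= in_itv/=.
  have /andP[x0 _] := x01.
  rewrite ler_pdivrMr ?exprn_gt0// ltr_pdivlMr ?exprn_gt0// mulrC.
  by rewrite -(nE i x Ci x01 Ui); apply: truncn_itv; rewrite mulr_ge0 ?exprn_ge0.
have : (lebesgue_measure ([set` `[0%R, 1%R[] : set R) <=
    \sum_(0 <= k <oo) lebesgue_measure (F k))%E.
  exact: measure_sigma_subadditive.
rewrite lebesgue_measure_itv/= lte_fin ltr01 -EFinB subr0 => /le_trans; apply.
rewrite nneseries_esumT// (eq_esum (b := fun k =>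
  if k \in f @` C then lebesgue_measure (F k) else 0%E)); last first.
  move=> k _; case: ifPn => //; rewrite notin_setE => /F0 ->.
  by rewrite measure0.
rewrite -esum_mkcond esum_image//.
by rewrite (eq_esum (b := fun i => (N%:R ^- l i)%:E))// => i Ci; rewrite Ff.
Qed.

End digits.

Lemma esumZl_le {R : realType} {I : choiceType} (C : set I) (k : R)
    (b : I -> \bar R) : 0 <= k -> (forall i, (0 <= b i)%E) ->
  (\esum_(i in C) (k%:E * b i) <= k%:E * \esum_(i in C) b i)%E.
Proof.
move=> k0 b0; apply: ge_ereal_sup => _ [A [finA AC] <-].
rewrite -ge0_mule_fsumr//; apply: lee_wpmul2l; first by rewrite lee_fin.
by apply: esum_ge; exists A.
Qed.

(** Mass distribution for a set that codes all sequences over [N] letters,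
    one letter being revealed by each time block of length [L]: an orbit ball
    of length [v] only meets points sharing their first [v %/ L] letters, and
    [N^-(v %/ L)] is at most a constant times [expR (- t * v)]. *)
Lemma coding_le_htop_eps {R : realType} {X : metricType R} (T : X -> X)
    (E : set X) (N L : nat) (t eps : R) (y : (nat -> nat) -> X) :
  (0 < N)%N -> (0 < L)%N -> 0 < eps -> 0 <= t -> expR (t * L%:R) <= N%:R ->
  (forall w, (forall k, (w k < N)%N) -> E (y w)) ->
  (forall w w', (forall k, (w k < N)%N) -> (forall k, (w' k < N)%N) ->
    forall k, (forall j, (j < k.+1 * L)%N ->
      mdist (iter j T (y w)) (iter j T (y w')) < eps + eps) -> w k = w' k) ->
  (t%:E <= htop_eps T E eps)%E.
Proof.
move=> N0 L0 eps0 t0 tN yE sep.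
have cL0 := expR_gt0 (t * L%:R).
apply: (@le_htop_eps _ _ _ _ _ _ (expR (t * L%:R))^-1); first by rewrite invr_gt0.
move=> n; apply: le_ereal_inf_tmp => _ [C [cC _ EC] <-].
pose l (p : X * nat) := (p.2 %/ L)%N.
pose U (p : X * nat) : set (nat -> nat) :=
  [set w | (forall k, (w k < N)%N) /\ bowen_ball T p.2 p.1 eps (y w)].
have : (1 <= \esum_(p in C) (N%:R ^- l p : R)%:E)%E.
  apply: (sum_cylinder_ge1 N0 (U := U)) => //.
    by move=> w wN; have [p Cp yp] := EC _ (yE w wN); exists p.
  move=> p w w' Cp [wN /bowen_ballP-/(_ eps0) yw] [w'N /bowen_ballP-/(_ eps0) yw'].
  move=> k kl; apply: sep => // j jk.
  have jp : (j < p.2)%N.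
    apply: leq_trans jk (leq_trans (leq_mul kl (leqnn L)) _).
    exact: leq_trunc_div.
  apply: le_lt_trans (metric_triangle _ (iter j T p.1) _) _.
  by rewrite ltrD// ?yw'// metric_sym yw.
(* [t * v <= t * L + t * L * (v %/ L)], the remainder of [v] being below [L] *)
move=> sum1.
have : (1 <= (expR (t * L%:R))%:E * \esum_(p in C) (expR (- t * p.2%:R))%:E)%E.
  apply: le_trans sum1 _.
  apply: le_trans (esumZl_le _ (expR_ge0 _) (fun p => expR_mul_nat_ge0 t p)).
  apply: le_esum => p _; rewrite -EFinM lee_fin -expRD.
  apply: (@le_trans _ _ (expR (t * L%:R) ^- l p)).
    by rewrite lef_pV2 ?posrE ?exprn_gt0 ?ltr0n// lerXn2r ?nnegrE ?expR_ge0.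
  rewrite -expRM_natr -expRN ler_expR -mulrA -natrM.
  rewrite mulNr -mulrBr -mulrN ler_wpM2l// lerBrDr addrC lerBlDr -natrD ler_nat.
  by rewrite [leqLHS](divn_eq _ L) [leqRHS]addnC mulnC leq_add2l ltnW ?ltn_mod.
by rewrite -lee_pdivrMl// mule1.
Qed.

(** * Uniformity from compactness *)

Section compactness.
Context {R : realType} {X : metricType R} (X_compact : compact [set: X]).
Implicit Types (x u : X) (r : R).

(** The form of compactness behind the three uniform bounds below: along a
    filter, a property that is locally uniform in the point is uniform. *)
Lemma compact_uniform {I : Type} (F : set_system I) {FF : Filter F}
    (P : I -> X -> Prop) :
  (forall x, exists2 r, 0 < r &
    \forall i \near F, forall u, mdist x u < r -> P i u) ->
  \forall i \near F, forall x, P i x.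
Proof.
move=> locP.
have near_cov : near_covering [set: X] by apply/compact_near_coveringP.
suff cov : \forall i \near F, [set: X] `<=` P i.
  by apply: (filterS _ cov) => i Pi x; exact: (Pi x).
apply: near_cov => x _; have [r r0 nearP] := locP x.
exists (([set u | mdist x u < r], [set i | forall u, mdist x u < r -> P i u])).
  by split=> //=; apply/metricType_numDomainType.nbhs_mdistP; exists r.
by move=> [u i] /= [xu]; exact.
Qed.

Lemma bounded_continuous (Phi : X -> R) : continuous Phi ->
  exists2 B, 0 < B & forall x, `|Phi x| <= B.
Proof.
move=> Phi_cont.
have [B PB] : exists B : R, forall x, `|Phi x| <= B.
  suff PB : \forall B \near pinfty_nbhs R, forall x, `|Phi x| <= B.
    exact: filter_ex PB.
  apply: compact_uniform => x.
  have /cvgrPdist_lt/(_ 1 ltr01)/metricType_numDomainType.nbhs_mdistP[r /= r0 xr] := Phi_cont x.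
  exists r => //; near=> B => u /xr; rewrite distrC => xu.
  have := ler_normD (Phi u - Phi x) (Phi x); rewrite subrK => /le_trans; apply.
  apply: (@le_trans _ _ (1 + `|Phi x|)); first by rewrite lerD2r ltW.
  by near: B; apply: nbhs_pinfty_ge; rewrite num_real.
exists (`|B| + 1) => [|x]; first by rewrite ltr_wpDl.
by apply: le_trans (PB x) _; rewrite (le_trans (ler_norm _))// lerDl.
Unshelve. all: by end_near. Qed.

Lemma unif_continuous_compact (Phi : X -> R) eta : continuous Phi -> 0 < eta ->
  exists2 r, 0 < r & forall x u, mdist x u < r -> `|Phi x - Phi u| <= eta.
Proof.
move=> Phi_cont eta0.
suff Pr : \forall r \near 0^'+,
    forall x u, mdist x u < r -> `|Phi x - Phi u| <= eta.
  have [r [r0 rP]] := filter_ex (filterI (nbhs_right_gt (0 : R)) Pr).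
  by exists r.
apply: compact_uniform => x.
have eta2 : 0 < eta / 2 by rewrite divr_gt0.
have /cvgrPdist_lt/(_ _ eta2)/metricType_numDomainType.nbhs_mdistP[r /= r0 xr] := Phi_cont x.
exists (r / 2); first by rewrite divr_gt0.
near=> s => v xv u vu.
have sr : s <= r / 2 by near: s; apply: nbhs_right_le; rewrite divr_gt0.
have xu : mdist x u < r.
  apply: le_lt_trans (metric_triangle _ v _) _.
  by rewrite [ltRHS]splitr ltrD// (lt_le_trans vu).
have xv' : mdist x v < r.
  by apply: lt_trans xv _; rewrite gtr_pMr ?invf_lt1// ltr1n.
rewrite -(subrK (Phi x) (Phi v)) -addrA.
apply: le_trans (ler_normD _ _) _.
by rewrite [leRHS]splitr lerD// ltW// ?xr// distrC xr.
Unshelve. all: by end_near. Qed.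

(** Applied to the lengths of connecting chains. As [Y] may fail to
    be closed, an index good at one point of [Y] is asked to be good at all the
    neighbouring ones, with the same radius [r]. *)
Lemma uniform_bound (Y : set X) (r : R) (Q : nat -> X -> Prop) : 0 < r ->
  (forall u, Y u -> exists k, forall v, Y v -> mdist u v < r -> Q k v) ->
  exists M, forall u, Y u -> exists2 k, (k <= M)%N & Q k u.
Proof.
move=> r0 locQ.
suff bound : \forall M \near \oo, forall u, Y u -> exists2 k, (k <= M)%N & Q k u.
  exact: filter_ex bound.
apply: compact_uniform => x.
exists (r / 2); first by rewrite divr_gt0.
have [[u Yu xu]|noY] := pselect (exists2 u, Y u & mdist x u < r / 2); last first.
  by near=> M => v xv Yv; case: noY; exists v.
have [k kQ] := locQ _ Yu.
near=> M => v xv Yv; exists k; first by near: M; exact: nbhs_infty_ge.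
apply: kQ => //; apply: le_lt_trans (metric_triangle _ x _) _.
by rewrite [ltRHS]splitr ltrD// metric_sym.
Unshelve. all: by end_near. Qed.

End compactness.

(** * Pieces of pseudo-orbits and chains *)

Section segments.
Context {R : realType} {X : metricType R} (T : X -> X).
Implicit Types (a b c u : X) (w : seq X) (delta eps : R).

(** A finite piece of pseudo-orbit, starting at [a] and whose last point is
    sent near [b]. The endpoint [b] does not belong to the piece, so that
    pieces can be concatenated; using [b] as the default value of [nth] makes
    it the term of index [size w]. *)
Definition segment delta a w b :=
  nth b w 0 = a /\
  forall i, (i < size w)%N -> mdist (T (nth b w i)) (nth b w i.+1) < delta.

Lemma nth_cat_segmentl delta b c w w' i :
  segment delta b w' c -> (i <= size w)%N -> nth c (w ++ w') i = nth b w i.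
Proof.
move=> [w'b _]; rewrite nth_cat leq_eqVlt => /orP[/eqP ->|iw].
  by rewrite ltnn subnn w'b nth_default.
by rewrite iw; exact: set_nth_default.
Qed.

Lemma segment_cat delta a b c w w' :
  segment delta a w b -> segment delta b w' c -> segment delta a (w ++ w') c.
Proof.
move=> [wa stepw] sw'; have [w'b stepw'] := sw'.
split=> [|i]; first by rewrite (nth_cat_segmentl sw').
rewrite size_cat => iww'; have [iw|wi] := ltnP i (size w).
  by rewrite !(nth_cat_segmentl sw') ?stepw// ltnW.
rewrite !nth_cat ltnNge wi/= ltnNge (leqW wi)/= subSn//.
by apply: stepw'; rewrite ltn_subLR.
Qed.

Lemma segment_nil delta b : segment delta b [::] b.
Proof. by []. Qed.

Lemma segment_pow delta b w r :
  segment delta b w b -> segment delta b (flatten (nseq r w)) b.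
Proof.
by move=> wb; elim: r => [|r IH]; [exact: segment_nil|exact: segment_cat wb IH].
Qed.

Lemma segment_orbit delta u b n : 0 < delta -> (0 < n)%N ->
  mdist (iter n T u) b < delta ->
  segment delta u (mkseq (fun i => iter i T u) n) b.
Proof.
move=> d0 n0 ub; split=> [|i]; first by rewrite nth_mkseq.
rewrite size_mkseq => iln; rewrite nth_mkseq// -iterS.
have [iln'|nli] := ltnP i.+1 n; first by rewrite nth_mkseq// mdistxx.
rewrite nth_default ?size_mkseq//.
by have -> : i.+1 = n by apply/eqP; rewrite eqn_leq iln.
Qed.

Definition chain_of_length delta k a b := exists x : nat -> X,
  [/\ x 0%N = a, x k = b &
      forall i, (i < k)%N -> mdist (T (x i)) (x i.+1) < delta].

Lemma chain_of_length_segment delta k a b : chain_of_length delta k a b ->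
  exists2 w, size w = k & segment delta a w b.
Proof.
move=> [x [xa xb stepx]].
have nthx i : (i <= k)%N -> nth b (mkseq x k) i = x i.
  rewrite leq_eqVlt => /orP[/eqP ->|ik]; last by rewrite nth_mkseq.
  by rewrite nth_default ?size_mkseq.
exists (mkseq x k); first by rewrite size_mkseq.
split=> [|i]; first by rewrite nthx.
by rewrite size_mkseq => ik; rewrite !nthx ?stepx// ltnW.
Qed.

Lemma chain_of_length_cat delta k l a b c :
  chain_of_length delta k a b -> chain_of_length delta l b c ->
  chain_of_length delta (k + l) a c.
Proof.
move=> [x [xa xb stepx]] [y [yb yc stepy]].
pose z i := if (i <= k)%N then x i else y (i - k)%N.
have zr i : (k <= i)%N -> z i = y (i - k)%N.
  rewrite /z => ki; case: ifPn => // ik.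
  have -> : i = k by apply/eqP; rewrite eqn_leq ik.
  by rewrite subnn xb yb.
exists z; split.
- by rewrite /z.
- by rewrite zr ?leq_addr// addKn.
move=> i ikl; have [ik|ki] := ltnP i k; first by rewrite /z ik ltnW// stepx.
by rewrite !zr ?leqW// subSn// stepy// ltn_subLR.
Qed.

Lemma chain_from_toP delta a b : chain_from_to T delta a b <->
  exists2 k, (0 < k)%N & chain_of_length delta k a b.
Proof.
split=> [[k [x [k0 xa xb xs]]]|[k k0 [x [xa xb xs]]]].
  by exists k => //; exists x.
by exists k, x.
Qed.

Lemma chain_from_to_trans delta a b c : chain_from_to T delta a b ->
  chain_from_to T delta b c -> chain_from_to T delta a c.
Proof.
move=> /chain_from_toP[k k0 ab] /chain_from_toP[l l0 bc].
apply/chain_from_toP; exists (k + l)%N; first by rewrite addn_gt0 k0.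
exact: chain_of_length_cat ab bc.
Qed.

Lemma chain_related_trans a b c :
  chain_related T a b -> chain_related T b c -> chain_related T a c.
Proof.
move=> ab bc e e0; have [ab1 ba1] := ab e e0; have [bc1 cb1] := bc e e0.
by split; [exact: chain_from_to_trans ab1 bc1|exact: chain_from_to_trans cb1 ba1].
Qed.

Lemma chain_related_sym a b : chain_related T a b -> chain_related T b a.
Proof. by move=> ab e /ab[]. Qed.

(** A chain returning from [u] can be made to start at [T u]: after dropping
    its first point, continuity of [T] at [T u] absorbs the first jump. *)
Lemma chain_related_image b u : continuous T ->
  chain_related T b u -> chain_related T b (T u).
Proof.
move=> T_cont bu e e0.
have e2 : 0 < e / 2 by rewrite divr_gt0.
have [r r0 Tr] : exists2 r, 0 < r &
    forall v, mdist (T u) v < r -> mdist (T (T u)) (T v) < e / 2.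
  apply/metricType_numDomainType.nbhs_mdistP; have := T_cont (T u).
  by move=> /cvg_ballP/(_ _ e2); rewrite ballEmdist.
have [bu1 _] := bu e e0.
have m0 : 0 < Num.min r (e / 2) by rewrite lt_min r0.
have [bu2 ub2] := bu _ m0.
split.
  apply: chain_from_to_trans bu1 _; apply/chain_from_toP; exists 1%N => //.
  exists (fun i => iter i T u); split=> // i; rewrite ltnS leqn0 => /eqP ->.
  by rewrite /= mdistxx.
(* Going round once more makes the chain long enough to have its first point
   dropped. *)
have /chain_from_toP[k k0 ub] := ub2.
have /chain_from_toP[l l0 bb] := chain_from_to_trans bu2 ub2.
have [x [xu xb stepx]] := chain_of_length_cat ub bb.
have kl2 : (2 <= k + l)%N by rewrite (leq_add k0 l0).
apply/chain_from_toP; exists (k + l).-1; first by rewrite -ltnS prednK// ltnW.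
exists (fun i => if i is 0%N then T u else x i.+1); split=> //.
  by case: (k + l)%N kl2 xb => [|[]].
move=> [_|i ikl]; last first.
  apply: lt_le_trans (stepx _ _) _; first by rewrite -ltn_predRL.
  by rewrite ge_min; apply/orP; right; lra.
apply: le_lt_trans (metric_triangle _ (T (x 1%N)) _) _.
rewrite [ltRHS]splitr ltrD//.
  apply: Tr; have := stepx 0%N (ltnW kl2); rewrite xu => /lt_le_trans; apply.
  by rewrite ge_min lexx.
by apply: lt_le_trans (stepx _ _) _ => //; rewrite ge_min lexx orbT.
Qed.

End segments.

(** * Closed pieces of pseudo-orbits in a chain class *)

Section loops.
Context {R : realType} {X : metricType R} (T : X -> X).
Context (X_compact : compact [set: X]) (T_cont : continuous T).
Context (b : X).
Implicit Types (u : X) (w : seq X) (delta eps : R).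

Lemma chain_related_iter u n :
  chain_related T b u -> chain_related T b (iter n T u).
Proof. by move=> bu; elim: n => //= n; exact: chain_related_image. Qed.

(** A chain to [u] is a chain to any point close to [u], of the same length:
    only its last point has to be moved. *)
Lemma chain_to_bounded delta : 0 < delta ->
  exists M, forall u, chain_related T b u ->
    exists2 k, (k <= M)%N & chain_of_length T delta k b u.
Proof.
move=> d0; have d2 : 0 < delta / 2 by rewrite divr_gt0.
apply: (uniform_bound X_compact (Y := [set u | chain_related T b u]) d2) => u bu.
have [/chain_from_toP[[//|k] _ [x [xb xu stepx]]] _] := bu _ d2.
exists k.+1 => v _ uv; exists (fun i => if i == k.+1 then v else x i).
split=> [//||i ik]; first by rewrite eqxx.
rewrite (ltn_eqF ik) eqSS; case: eqVneq => [->|_].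
  apply: le_lt_trans (metric_triangle _ u _) _.
  by rewrite [ltRHS]splitr ltrD// -xu stepx.
by apply: lt_trans (stepx _ ik) _; lra.
Qed.

(** A jump from [u] to a nearby point of the class is allowed before the chain,
    so that one chain serves all the neighbours of its starting point. *)
Lemma chain_from_bounded delta : 0 < delta ->
  exists M, forall u, chain_related T b u -> exists2 k, (k <= M)%N &
    exists2 a, mdist u a < delta & chain_of_length T delta k a b.
Proof.
move=> d0.
apply: (uniform_bound X_compact (Y := [set u | chain_related T b u])
  (Q := fun k u => exists2 a, mdist u a < delta &
          chain_of_length T delta k a b) d0) => u bu.
have [_ /chain_from_toP[k _ ub]] := bu _ d0.
by exists k => v _ uv; exists u => //; rewrite metric_sym.
Qed.

(** The connecting pieces have lengths bounded independently of [n]: closing up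
    a long orbit piece hardly changes its length or its average. *)
Lemma loop_through delta : 0 < delta ->
  exists M, forall u n, chain_related T b u -> (0 < n)%N ->
    exists w1 w2, [/\ (size w1 <= M)%N, (size w2 <= M)%N &
      segment T delta b (w1 ++ mkseq (fun i => iter i T u) n ++ w2) b].
Proof.
move=> d0; have [M1 toM] := chain_to_bounded d0.
have [M2 fromM] := chain_from_bounded d0.
exists (maxn M1 M2) => u n bu n0.
have [k1 k1M /chain_of_length_segment[w1 szw1 bw1]] := toM _ bu.
have [k2 k2M [a ua /chain_of_length_segment[w2 szw2 w2b]]] :=
  fromM _ (chain_related_iter n bu).
have wu := segment_orbit d0 n0 ua.
exists w1, w2; split.
- by rewrite szw1 leq_max k1M.
- by rewrite szw2 leq_max k2M orbT.
- exact: segment_cat bw1 (segment_cat wu w2b).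
Qed.

(** Loops through orbit pieces of a common length need not have the same length
    and need not run through these pieces at the same time. Keeping only the
    points that share the most frequent pair of lengths of connecting pieces,
    which divides their number by at most [M.+1 ^ 2], synchronizes the loops, so
    that they are separated because the points are. *)
Lemma separated_loops delta : 0 < delta ->
  exists M, forall n eps S N (s : nat -> X), (0 < n)%N ->
    (forall i, (i <= S)%N -> chain_related T b (s i)) ->
    (forall i j, (i < j)%N -> (j <= S)%N -> exists2 l, (l < n)%N &
       eps <= mdist (iter l T (s i)) (iter l T (s j))) ->
    (N * M.+1 ^ 2 <= S.+1)%N ->
    exists m, (n <= m <= n + M.*2)%N /\ exists W : nat -> seq X,
      (forall i, (i < N)%N -> size (W i) = m /\ segment T delta b (W i) b) /\
      (forall i j, (i < N)%N -> (j < N)%N -> i <> j -> exists2 l, (l < m)%N &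
        eps <= mdist (nth b (W i) l) (nth b (W j) l)).
Proof.
move=> d0; have [M loopM] := loop_through d0; exists M => n eps S N s n0 bs sep NS.
pose orb i := mkseq (fun l => iter l T (s i)) n.
have /choice[f fP] : forall i : 'I_S.+1, exists w : seq X * seq X,
    [/\ (size w.1 <= M)%N, (size w.2 <= M)%N &
      segment T delta b (w.1 ++ orb i ++ w.2) b].
  move=> i; have si : chain_related T b (s i) by apply: bs; rewrite -ltnS.
  by have [w1 [w2 w12]] := loopM _ _ si n0; exists (w1, w2).
pose sizes i : 'I_M.+1 * 'I_M.+1 := (inord (size (f i).1), inord (size (f i).2)).
have [c cN] : exists c, (N <= #|[pred i | sizes i == c]|)%N.
  apply: contrapT => /forallNP few.
  have : (\sum_(c : 'I_M.+1 * 'I_M.+1) #|[pred i | sizes i == c]| < N * M.+1 ^ 2)%N.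
    have -> : (N * M.+1 ^ 2 = \sum_(c : 'I_M.+1 * 'I_M.+1) N)%N.
      by rewrite sum_nat_const card_prod card_ord mulnC mulnn.
    apply: (@leq_trans (\sum_(c : 'I_M.+1 * 'I_M.+1) #|[pred i | sizes i == c]|.+1)).
      under [leqRHS]eq_bigr do rewrite -addn1.
      by rewrite big_split/= sum1_card card_prod card_ord -addn1 leq_add2l.
    by apply: leq_sum => c _; rewrite ltnNge; apply/negP/few.
  rewrite ltnNge (leq_trans NS)// -[leqLHS]card_ord -sum1_card.
  rewrite (partition_big sizes xpredT)//=.
  by apply: leq_sum => c _; rewrite sum1_card.
pose e := enum [pred i | sizes i == c].
pose g := nth ord0 e.
have size_f i : (i < N)%N -> size (f (g i)).1 = c.1 /\ size (f (g i)).2 = c.2.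
  move=> iN; have : g i \in e by rewrite mem_nth// -cardE (leq_trans iN).
  have [s1 s2 _] := fP (g i).
  by rewrite mem_enum inE => /eqP <- /=; rewrite !inordK.
exists (c.1 + n + c.2)%N; split.
  by have := ltn_ord c.1; have := ltn_ord c.2; lia.
exists (fun i => (f (g i)).1 ++ orb (g i) ++ (f (g i)).2); split=> [i iN|i j iN jN ij].
  have [_ _ ?] := fP (g i); have [s1 s2] := size_f i iN; split=> //.
  by rewrite !size_cat s1 s2 size_mkseq addnA.
have nthW k l : (k < N)%N -> (l < n)%N ->
    nth b ((f (g k)).1 ++ orb (g k) ++ (f (g k)).2) (c.1 + l) =
    iter l T (s (g k)).
  move=> kN ln; have [s1 _] := size_f k kN.
  by rewrite nth_cat s1 ltnNge leq_addr/= addKn nth_cat size_mkseq ln nth_mkseq.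
have {}sep (p q : 'I_S.+1) : p <> q -> exists2 l, (l < n)%N &
    eps <= mdist (iter l T (s p)) (iter l T (s q)).
  move=> pq; have [lt_pq|lt_qp|/val_inj//] := ltngtP p q.
    by apply: sep lt_pq _; rewrite -ltnS.
  have [|l ln lsep] := sep _ _ lt_qp; first by rewrite -ltnS.
  by exists l; rewrite // metric_sym.
have [|l ln lsep] := sep (g i) (g j).
  move=> /eqP; rewrite nth_uniq ?enum_uniq// -?cardE ?(leq_trans iN)//; last first.
    by rewrite (leq_trans jN).
  by move/eqP.
exists (c.1 + l)%N; last by rewrite !nthW.
by rewrite -addnA ltn_add2l ltn_addr.
Qed.

End loops.

(** * Birkhoff averages along sequences of blocks *)

Lemma cvgn_cauchyP {R : realType} (v : nat -> R) :
  cvg (v n @[n --> \oo]) <->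
  forall e, 0 < e -> exists n0, forall m n, (n0 <= m)%N -> (n0 <= n)%N ->
    `|v m - v n| < e.
Proof.
split=> [/cvg_ex[l /cvgrPdist_lt vl] e e0|cauchy_v].
  have [|n0 _ n0P] := vl (e / 2); first by rewrite divr_gt0.
  exists n0 => m n n0m n0n; rewrite [ltRHS]splitr -(subrK l (v m)) -addrA.
  by apply: le_lt_trans (ler_normD _ _) _; rewrite ltrD ?(distrC _ l) ?n0P.
apply: cauchy_cvg; apply: cauchy_exP => e e0; have [n0 n0P] := cauchy_v e e0.
exists (v n0); exists n0 => // n n0n /=; exact: n0P.
Qed.

Section block_sequences.
Context {R : realType} {X : metricType R} (T : X -> X) (b : X) (L : nat).
Context (L_gt0 : (0 < L)%N).
Implicit Types (v : nat -> seq X).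

Definition concat_blocks v i := nth b (v (i %/ L)%N) (i %% L).

Lemma concat_blocksE v k l : (l < L)%N ->
  concat_blocks v (k * L + l) = nth b (v k) l.
Proof.
by move=> lL; rewrite /concat_blocks divnMDl// divn_small// addn0 modnMDl modn_small.
Qed.

Lemma concat_blocks_pseudo_orbit delta v :
  (forall k, size (v k) = L /\ segment T delta b (v k) b) ->
  pseudo_orbit T delta (concat_blocks v).
Proof.
move=> vP i; rewrite (divn_eq i L) -addnS.
have iL : (i %% L < L)%N by rewrite ltn_mod.
have [szv [_ stepv]] := vP (i %/ L)%N.
rewrite concat_blocksE//; have := stepv (i %% L)%N; rewrite szv => /(_ iL).
have [iL'|Li] := ltnP (i %% L).+1 L; first by rewrite concat_blocksE.
have -> : (i %% L).+1 = L by apply/eqP; rewrite eqn_leq iL.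
have [_ [v0 _]] := vP (i %/ L).+1.
rewrite addnC -mulSn -[(_ * L)%N]addn0 concat_blocksE// v0.
by rewrite [nth b _ L]nth_default ?szv.
Qed.

Lemma sum_concat_blocks (Phi : X -> R) v k : (forall k, size (v k) = L) ->
  \sum_(0 <= i < k * L) Phi (concat_blocks v i) =
  \sum_(0 <= j < k) \sum_(x <- v j) Phi x.
Proof.
move=> szv; rewrite big_nat_mul; apply: eq_bigr => j _.
rewrite mulSn -[X in index_iota X _]add0n big_addn addnK [RHS](big_nth b) szv.
rewrite big_nat [RHS]big_nat; apply: eq_bigr => i /andP[_ iL].
by rewrite addnC concat_blocksE.
Qed.

End block_sequences.

(** The switch is constant on each interval from [4 ^ i] to [4 ^ i.+1], which
    is long enough for the frequency of [true] to come down to 1/4 and up to 3/4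
    infinitely often. *)
Definition stage (j : nat) : bool := odd (trunc_log 4 j).

Lemma stageE i j : (4 ^ i <= j < 4 ^ i.+1)%N -> stage j = odd i.
Proof. by move=> ij; rewrite /stage (trunc_log_eq _ ij). Qed.

Lemma stage_frequency i :
  if odd i then (3 * 4 ^ i.+1 <= 4 * \sum_(0 <= j < 4 ^ i.+1) stage j)%N
  else (4 * \sum_(0 <= j < 4 ^ i.+1) stage j <= 4 ^ i.+1)%N.
Proof.
have le4 : (4 ^ i <= 4 ^ i.+1)%N by rewrite leq_exp2l.
rewrite (big_cat_nat (n := 4 ^ i))//=.
have -> : (\sum_(4 ^ i <= j < 4 ^ i.+1) stage j = 3 * 4 ^ i * odd i)%N.
  rewrite big_nat (eq_bigr (fun=> odd i : nat)) -?big_nat; last first.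
    by move=> j ij; rewrite (stageE ij).
  by rewrite sum_nat_const_nat expnS; congr (_ * _)%N; lia.
have : (\sum_(0 <= j < 4 ^ i) stage j <= 4 ^ i)%N.
  rewrite -[leqRHS]subn0 -[leqRHS]muln1 -sum_nat_const_nat.
  by apply: leq_sum => j _; case: stage.
by rewrite expnS; case: (odd i); lia.
Qed.

Section irregular.
Context {R : realType} {X : metricType R} (T : X -> X) (Phi : X -> R).

(** If two points shadow block sequences whose Birkhoff sums only differ on
    the stages of [true], by a fixed amount per block, then the difference of
    their averages follows the frequency of [true], hence oscillates: the
    averages cannot both converge. *)
Lemma staged_irregular (b y0 y1 : X) (v0 v1 : nat -> seq X) (L : nat)
    (eta D : R) :
  (0 < L)%N -> 0 < eta -> eta * 12 * L%:R <= D ->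
  (forall k, size (v0 k) = L) -> (forall k, size (v1 k) = L) ->
  (forall k, \sum_(x <- v1 k) Phi x = \sum_(x <- v0 k) Phi x + D *+ stage k) ->
  (forall i, `|Phi (iter i T y0) - Phi (concat_blocks b L v0 i)| <= eta) ->
  (forall i, `|Phi (iter i T y1) - Phi (concat_blocks b L v1 i)| <= eta) ->
  irregular_set T Phi y0 \/ irregular_set T Phi y1.
Proof.
move=> L0 eta0 le_D sz0 sz1 sumv close0 close1.
apply: contrapT => /not_orP[/contrapT cvg0 /contrapT cvg1].
have [n0 n0P] := (cvgn_cauchyP _).1 cvg0 eta eta0.
have [n1 n1P] := (cvgn_cauchyP _).1 cvg1 eta eta0.
have sumE y v k : (forall k, size (v k) = L) ->
    (forall i, `|Phi (iter i T y) - Phi (concat_blocks b L v i)| <= eta) ->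
    `|\sum_(0 <= i < k * L) Phi (iter i T y) -
      \sum_(0 <= j < k) \sum_(x <- v j) Phi x| <= eta * (k * L)%:R.
  move=> szv close; rewrite -(sum_concat_blocks b L0)// -sumrB.
  apply: le_trans (ler_norm_sum _ _ _) _.
  apply: (@le_trans _ _ (\sum_(0 <= i < k * L) eta)).
    by apply: ler_sum => i _.
  by rewrite sumr_const_nat subn0 mulr_natr.
pose a k := birkhoff_average T Phi y1 (k * L) - birkhoff_average T Phi y0 (k * L).
have aE k : (0 < k)%N ->
    `|k%:R * L%:R * a k - D * (\sum_(0 <= j < k) stage j)%:R| <= 2 * eta * (k%:R * L%:R).
  move=> k0; have kL0 : k%:R * L%:R != 0 :> R.
    by rewrite -natrM pnatr_eq0 muln_eq0 negb_or -!lt0n k0.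
  have -> : D * (\sum_(0 <= j < k) stage j)%:R =
      \sum_(0 <= j < k) \sum_(x <- v1 j) Phi x -
      \sum_(0 <= j < k) \sum_(x <- v0 j) Phi x.
    rewrite natr_sum mulr_sumr -sumrB; apply: eq_bigr => j _.
    by rewrite sumv addrAC subrr add0r mulr_natr.
  rewrite /a /birkhoff_average natrM mulrBr !mulrA divff// !mul1r.
  have := sumE _ _ k sz0 close0; have := sumE _ _ k sz1 close1.
  by rewrite natrM !ler_norml => /andP[? ?] /andP[? ?]; apply/andP; split; lra.
(* An even stage [p], where the frequency is at most 1/4, followed by an odd
   one, where it is at least 3/4. *)
pose p := (maxn n0 n1).*2; pose k i := (4 ^ i.+1)%N.
have k0 i : (0 < k i)%N by rewrite expn_gt0.
have kL i : (p <= i)%N -> (maxn n0 n1 <= k i * L)%N.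
  move=> pi; apply: leq_trans (leq_pmulr _ L0); apply: leq_trans (ltnW (ltn_expl i.+1 _)) => //.
  by rewrite /p in pi; lia.
have L0R : 0 < L%:R :> R by rewrite ltr0n.
have kR i : 0 < (k i)%:R :> R by rewrite ltr0n.
have D0 : 0 < D by apply: lt_le_trans le_D; rewrite !mulr_gt0.
have freq i := stage_frequency i.
have low : a (k p) * (L%:R * 4) <= D + 8 * eta * L%:R.
  have := freq p; rewrite {1}/p odd_double -/(k p) -(ler_nat R) (natrM _ 4) => fq.
  have /ler_normlP[_ h] := aE _ (k0 p).
  rewrite -(ler_pM2r (kR p)).
  have := ler_wpM2l (ltW D0) fq.
  lra.
have high : 3 * D - 8 * eta * L%:R <= a (k p.+1) * (L%:R * 4).
  have := freq p.+1; rewrite oddS {1}/p odd_double -/(k p.+1) -(ler_nat R).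
  rewrite (natrM _ 3 (k p.+1)) (natrM _ 4) => fq.
  have /ler_normlP[h _] := aE _ (k0 p.+1).
  rewrite -(ler_pM2r (kR p.+1)).
  have := ler_wpM2l (ltW D0) fq.
  lra.
have kLp := kL _ (leqnn p); have kLp1 := kL _ (leqnSn p).
rewrite geq_max in kLp; rewrite geq_max in kLp1.
have /andP[a0 a1] := kLp; have /andP[b0 b1] := kLp1.
have /ltr_normlP[_ h0] := n0P _ _ a0 b0.
have /ltr_normlP[_ h1] := n1P _ _ b1 a1.
have : a (k p.+1) - a (k p) < 2 * eta by rewrite /a; lra.
rewrite -(ltr_pM2r L0R); lra.
Qed.

End irregular.

(** * Loops with different averages *)

Section birkhoff_loops.
Context {R : realType} {X : metricType R} (T : X -> X) (Phi : X -> R).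
Context (X_compact : compact [set: X]) (T_cont : continuous T).
Implicit Types (b : X) (w : seq X).

Lemma ler_norm_sum_seq B w : (forall x, `|Phi x| <= B) ->
  `|\sum_(x <- w) Phi x| <= B * (size w)%:R.
Proof.
move=> PB; apply: le_trans (ler_norm_sum _ _ _) _.
elim: w => [|x w IH]; first by rewrite big_nil mulr0.
by rewrite big_cons /= -addn1 natrD mulrDr mulr1 addrC lerD.
Qed.

Lemma sum_flatten_nseq r w :
  \sum_(x <- flatten (nseq r w)) Phi x = (\sum_(x <- w) Phi x) * r%:R.
Proof.
elim: r => [|r IH]; first by rewrite big_nil mulr0.
by rewrite /= big_cat/= IH -addn1 natrD mulrDr mulr1 addrC.
Qed.

Lemma size_flatten_nseq r w : size (flatten (nseq r w)) = (size w * r)%N.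
Proof. by rewrite size_flatten /shape map_nseq sumn_nseq. Qed.

(** Along the irregular point [b] there are arbitrarily long orbit pieces with
    averages at distance at least some [gamma]; closing them up hardly changes
    their averages, and repeating each as many times as the length of the other
    makes their lengths equal. *)
Lemma oscillating_loops b : continuous Phi -> chain_related T b b ->
  irregular_set T Phi b ->
  exists2 gamma, 0 < gamma & forall delta, 0 < delta ->
    exists D0 D1, [/\ (0 < size D0)%N, size D1 = size D0,
      segment T delta b D0 b, segment T delta b D1 b &
      \sum_(x <- D0) Phi x + gamma * (size D0)%:R <= \sum_(x <- D1) Phi x].
Proof.
move=> Phi_cont bb irr.
have [B B0 PB] := bounded_continuous X_compact Phi_cont.
have [g g0 gP] : exists2 g, 0 < g & forall n, exists p q,
    [/\ (n <= p)%N, (n <= q)%N &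
      birkhoff_average T Phi b q + g <= birkhoff_average T Phi b p].
  apply: contrapT => /forall2NP nog; apply: irr; apply/cvgn_cauchyP => e e0.
  have [//|/existsNP[n0 n0P]] := nog e; exists n0 => p q n0p n0q.
  have [//|] := ltP `|birkhoff_average T Phi b p - birkhoff_average T Phi b q| e.
  rewrite ler_normr => /orP[h|h]; case: n0P.
    by exists p, q; split=> //; lra.
  by exists q, p; split=> //; lra.
exists (g / 2) => [|delta d0]; first by rewrite divr_gt0.
have [M loopM] := @loop_through _ _ T X_compact T_cont b _ d0.
pose C := 2 * M%:R * B.
have C0 : 0 <= C by rewrite !mulr_ge0// ltW.
(* A loop closing up the first [n] points of the orbit of [b]: its sum is that
   of a loop of the same length with the average of the orbit piece, up to a
   constant. *)
have closeup n : (0 < n)%N -> exists w, [/\ (n <= size w)%N, segment T delta b w b &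
    `|\sum_(x <- w) Phi x - birkhoff_average T Phi b n * (size w)%:R| <= 2 * C].
  move=> n0; have [w1 [w2 [w1M w2M bw]]] := loopM _ n bb n0.
  eexists; split; [|exact: bw|].
    by rewrite !size_cat size_mkseq addnCA leq_addr.
  have nR : n%:R != 0 :> R by rewrite pnatr_eq0 -lt0n.
  set s := birkhoff_average T Phi b n.
  have sE : \sum_(x <- mkseq (fun i => iter i T b) n) Phi x = s * n%:R.
    rewrite /s /birkhoff_average mulrC mulrA divff// mul1r.
    by rewrite big_map /index_iota subn0.
  have sB : `|s| <= B.
    rewrite -(ler_pM2r (_ : 0 < n%:R)) ?ltr0n//.
    rewrite -[n%:R in X in X <= _]normr_nat -normrM -sE.
    by have := ler_norm_sum_seq (mkseq (fun i => iter i T b) n) PB; rewrite size_mkseq.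
  rewrite !big_cat/= sE !size_cat size_mkseq !natrD.
  have sk k : (k <= M)%N -> `|s * k%:R| <= B * M%:R.
    by move=> kM; rewrite normrM normr_nat ler_pM// ler_nat.
  have Bk k : (k <= M)%N -> B * k%:R <= B * M%:R.
    by move=> kM; rewrite ler_wpM2l ?(ltW B0)// ler_nat.
  have /ler_normlP[h1 h2] := sk _ w1M; have /ler_normlP[h3 h4] := sk _ w2M.
  have := ler_norm_sum_seq w1 PB.
  move=> /le_trans/(_ (Bk _ w1M))/ler_normlP[h5 h6].
  have := ler_norm_sum_seq w2 PB.
  move=> /le_trans/(_ (Bk _ w2M))/ler_normlP[h7 h8].
  by rewrite ler_norml /C; apply/andP; split; lra.
(* From [n1] on, the error made in closing up costs at most half of [g]. *)
pose n1 := (Num.truncn (8 * C / g)).+1.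
have n1P : 8 * C <= g * n1%:R.
  by rewrite [leRHS]mulrC -ler_pdivrMr// ltW// truncnS_gt.
have [p [q [n1p n1q gap]]] := gP n1.
have [A [pA bA sA]] := closeup p (leq_trans (ltn0Sn _) n1p).
have [A' [qA' bA' sA']] := closeup q (leq_trans (ltn0Sn _) n1q).
exists (flatten (nseq (size A) A')), (flatten (nseq (size A') A)).
rewrite !size_flatten_nseq !sum_flatten_nseq mulnC.
split=> //; [|exact: segment_pow|exact: segment_pow|].
  have n10 : (0 < n1)%N by [].
  by rewrite muln_gt0 (leq_trans n10 (leq_trans n1p pA)) (leq_trans n10 (leq_trans n1q qA')).
rewrite natrM.
have a1 : n1%:R <= (size A)%:R :> R by rewrite ler_nat (leq_trans n1p).
have a2 : n1%:R <= (size A')%:R :> R by rewrite ler_nat (leq_trans n1q).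
move: sA sA' gap a1 a2.
set sp := birkhoff_average _ _ _ p; set sq := birkhoff_average _ _ _ q.
set a := (size A)%:R; set a' := (size A')%:R.
set SA := \sum_(x <- A) _; set SA' := \sum_(x <- A') _.
move=> /ler_normlP[h1 _] /ler_normlP[_ h2] gap a1 a2.
have a0 : 0 <= a by []. have a'0 : 0 <= a' by [].
have e1 := ler_wpM2l a'0 h1. have e2 := ler_wpM2l a0 h2.
have e3 := ler_wpM2l (mulr_ge0 a0 a'0) gap.
have e4 := ler_wpM2l (ltW g0) a1. have e5 := ler_wpM2l (ltW g0) a2.
have e6 := ler_wpM2l a'0 (le_trans n1P e4). have e7 := ler_wpM2l a0 (le_trans n1P e5).
lra.
Qed.

End birkhoff_loops.

(** * Irregular points carrying the entropy of the class *)

Section assembly.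
Context {R : realType} {X : metricType R} (T : X -> X) (Phi : X -> R).
Context (X_compact : compact [set: X]) (T_cont : continuous T).
Context (T_shadowing : shadowing T) (Phi_cont : continuous Phi).

(** Each block is a separated loop, which carries the entropy, followed by a
    tail of relative length about [1 / K], which is one of two loops with
    different averages. A small proportion of tails costs little entropy; being
    fixed, it still makes the averages oscillate by a definite amount when the
    tails are switched by stages. Since the averages of the separated loops are
    not controlled, two pseudo-orbits with the same loops are compared, one with
    constant tails and one with switched tails: at least one of them is shadowed
    by an irregular point, and either codes the sequence of loops. *)
Lemma irregular_htop_eps_ge (b : X) (Y : set X) (eps t t1 : R) :
  chain_related T b b -> irregular_set T Phi b ->
  Y `<=` [set u | chain_related T b u] ->
  0 < eps -> 0 < t -> t < t1 -> (t1%:E < htop_eps T Y eps)%E ->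
  (t%:E <= htop_eps T (irregular_set T Phi) (eps / 4))%E.
Proof.
move=> bb irr Yb eps0 t0 tt1 t1Y.
have [c [n0 [c0 pre_ge]]] := lt_htop_eps t1Y.
have [gamma gamma0 loopsP] := oscillating_loops X_compact T_cont Phi_cont bb irr.
(* A block of loop length [m] has total length at most [m * (1 + 2 / K)], hence
   the intermediate exponent [t2]. *)
have [K K0 tK] : exists2 K, 0 < K%:R :> R & 2 * t < K%:R * (t1 - t).
  exists (Num.truncn (2 * t / (t1 - t))).+1; first by rewrite ltr0n.
  by rewrite -ltr_pdivrMr ?subr_gt0// truncnS_gt.
pose t2 := t * (1 + 2 / K%:R).
have t2E : K%:R * t2 = t * (K%:R + 2).
  by rewrite /t2; field; rewrite gt_eqF.
have t20 : 0 < t2 by rewrite mulr_gt0// addr_gt0// divr_gt0.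
have t2t1 : t2 < t1.
  by rewrite -(ltr_pM2l K0) t2E; lra.
(* The averages of the two pseudo-orbits differ by the frequency of switched
   tails times at least [gamma / (K + 1)]; [eta] bounds the shadowing error. *)
pose eta := gamma / (12 * (K%:R + 1)).
have K1 : 0 < K%:R + 1 :> R by rewrite addr_gt0.
have eta0 : 0 < eta by rewrite divr_gt0// mulr_gt0.
have [r r0 rP] := unif_continuous_compact X_compact Phi_cont eta0.
(* Two shadowing errors and the diameter of a ball of radius [eps / 4] add up
   to [eps]. *)
have eps4 : 0 < eps / 4 by rewrite divr_gt0.
have eps1_gt0 : 0 < Num.min (eps / 4) r by rewrite lt_min eps4.
have [delta delta0 shadowP] := T_shadowing eps1_gt0.
have [D0 [D1 [szD0 szD1 bD0 bD1 sumD]]] := loopsP _ delta0.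
set P0 := size D0 in szD0 szD1 sumD.
have [M sepM] := separated_loops X_compact T_cont b delta0.
(* [n] is chosen so long that [N > expR (t2 * (n + 2 * M))] synchronized loops
   are left after the loss of the factor [Q]. *)
pose Q := (M.+1 ^ 2)%N.
have Q0 : (0 < Q)%N by rewrite expn_gt0.
pose G := 2 * Q%:R * expR (t2 * M.*2%:R) / c.
have [n [n_gt0 n0n KPn Gn]] : exists n, [/\ (0 < n)%N, (n0 <= n)%N,
    (K * P0 <= n)%N & G < (t1 - t2) * n%:R].
  exists (n0 + K * P0 + (Num.truncn (G / (t1 - t2))).+1)%N; split.
  - by rewrite addnS.
  - by rewrite -addnA leq_addr.
  - by rewrite addnAC leq_addl.
  rewrite mulrC -ltr_pdivrMr ?subr_gt0//; apply: lt_le_trans (truncnS_gt _) _.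
  by rewrite ler_nat leq_addl.
pose E := expR (t2 * (n + M.*2)%:R).
have E1 : 1 <= E by rewrite -expR0 ler_expR mulr_ge0// ltW.
have [N EN NE] : exists2 N, E < N%:R & N%:R <= 2 * E.
  exists (Num.truncn E).+1; first exact: truncnS_gt.
  have /andP[h _] := truncn_itv (le_trans ler01 E1).
  by rewrite -natr1; lra.
have N0 : (0 < N)%N by rewrite -(ltr0n R) (lt_trans _ EN) ?expR_gt0.
have few : (N * Q).-1%:R * expR (- t1 * n%:R) < c.
  rewrite mulNr expRN ltr_pdivrMr ?expR_gt0//.
  apply: (@le_lt_trans _ _ (2 * E * Q%:R)).
    apply: (@le_trans _ _ (N * Q)%:R); first by rewrite ler_nat leq_pred.
    by rewrite natrM ler_wpM2r.
  have -> : 2 * E * Q%:R = c * (G * expR (t2 * n%:R)).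
    by rewrite /E natrD mulrDr expRD /G; field; rewrite gt_eqF.
  rewrite ltr_pM2l// -ltr_pdivlMr ?expR_gt0// -expRB -mulrBl.
  apply: lt_le_trans (expR_ge1Dx _).
  by lra.
have [s [sY ssep]] := greedy_separated (pre_ge n n0n) few.
have NQ : (N * Q <= (N * Q).-1.+1)%N by rewrite leqSpred.
have [i iS|i j ij jS|m [/andP[nm mn] [W [WP Wsep]]]] :=
    sepM n eps _ N s n_gt0 _ _ NQ.
- by apply: Yb; exact: sY.
- apply: contrapT => /forall2NP noS; apply: (ssep i j ij jS).
  apply/bowen_ballP => // l ln; have [//|/negP] := noS l.
  by rewrite -ltNge.
(* The tails are repeated [q] times to have a length [P] between [m / K] and
   [2 * m / K]. *)
have [q KPle KPge] : exists2 q, (K * (P0 * q) <= 2 * m)%N & (m <= K * (P0 * q))%N.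
  have KP0 : (0 < K * P0)%N by rewrite muln_gt0 szD0 -(ltr0n R) K0.
  exists (m %/ (K * P0)).+1; last by rewrite mulnA mulnC ltnW// ltn_ceil.
  rewrite mulnA mulnS mul2n -addnn leq_add ?(leq_trans KPn)// mulnC.
  exact: leq_trunc_div.
pose P := (P0 * q)%N; pose L := (m + P)%N.
have L0 : (0 < L)%N by rewrite addn_gt0 (leq_trans n_gt0 nm).
pose V g (tau : bool) := W g ++ flatten (nseq q (if tau then D1 else D0)).
have VP g tau : (g < N)%N -> size (V g tau) = L /\ segment T delta b (V g tau) b.
  move=> gN; have [szW bW] := WP g gN.
  split; first by rewrite /V size_cat szW size_flatten_nseq; case: tau; rewrite ?szD1.
  by apply: segment_cat bW _; apply: segment_pow; case: tau.
have nthV g tau l : (g < N)%N -> (l < m)%N -> nth b (V g tau) l = nth b (W g) l.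
  by move=> gN lm; rewrite /V nth_cat (WP g gN).1 lm.
pose Delta := (\sum_(x <- D1) Phi x - \sum_(x <- D0) Phi x) * q%:R.
have sumV g tau : \sum_(x <- V g tau) Phi x =
    \sum_(x <- V g false) Phi x + Delta *+ tau.
  rewrite /V !big_cat/= !sum_flatten_nseq /Delta.
  by case: tau => /=; rewrite ?mulr1n ?mulr0n; ring.
have LDelta : eta * 12 * L%:R <= Delta.
  have qR : 0 <= q%:R :> R by [].
  apply: (@le_trans _ _ (gamma * P%:R)); last first.
    rewrite /P natrM mulrA /Delta ler_wpM2r//; lra.
  have LP : L%:R <= (K%:R + 1) * P%:R :> R.
    by rewrite natr1 -natrM ler_nat /L mulSn addnC leq_add2l.
  have -> : eta * 12 * L%:R = gamma * (L%:R / (K%:R + 1)).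
    by rewrite /eta; field; rewrite gt_eqF.
  by rewrite ler_pM2l// ler_pdivrMr// mulrC.
have tL : expR (t * L%:R) <= N%:R.
  apply: le_trans (ltW EN); rewrite ler_expR.
  apply: (@le_trans _ _ (t2 * m%:R)); last by rewrite ler_pM2l// ler_nat.
  rewrite -(ler_pM2l K0) [leRHS]mulrA t2E mulrCA -mulrA ler_pM2l//.
  rewrite -(natrD _ K 2) -!natrM ler_nat /L mulnDr mulnDl leq_add2l.
  exact: KPle.
pose z w tau := concat_blocks b L (fun k => V (w k) (tau k)).
have /choice[y yP] : forall w : nat -> nat, exists y, (forall k, (w k < N)%N) ->
    irregular_set T Phi y /\ exists tau, forall i,
      mdist (iter i T y) (z w tau i) < Num.min (eps / 4) r.
  move=> w; have [wN|nwN] := pselect (forall k, (w k < N)%N); last by exists b.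
  have shz tau : exists y, forall i,
      mdist (iter i T y) (z w tau i) < Num.min (eps / 4) r.
    by apply: shadowP; apply: concat_blocks_pseudo_orbit => // k; exact: VP.
  have [y0 y0P] := shz (fun=> false); have [y1 y1P] := shz stage.
  have closeness y tau : (forall i,
      mdist (iter i T y) (z w tau i) < Num.min (eps / 4) r) ->
      forall i, `|Phi (iter i T y) - Phi (z w tau i)| <= eta.
    move=> yz i; apply: rP; apply: lt_le_trans (yz i) _.
    by rewrite ge_min lexx orbT.
  have [||k|irr0|irr1] := staged_irregular L0 eta0 LDelta _ _ _
      (closeness _ _ y0P) (closeness _ _ y1P).
  - by move=> k; have [] := VP (w k) false (wN k).
  - by move=> k; have [] := VP (w k) (stage k) (wN k).
  - exact: sumV.
  - by exists y0 => _; split=> //; exists (fun=> false).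
  - by exists y1 => _; split=> //; exists stage.
(* Points whose orbits stay close during the block [k] shadow loops that are not
   separated, whatever the tails. *)
apply: (coding_le_htop_eps (y := y) _ L0 eps4 (ltW t0) tL) => //.
  by move=> w /yP[].
move=> w w' wN w'N k close; apply: contrapT => ww'.
have [l lm lsep] := Wsep _ _ (wN k) (w'N k) ww'.
have [_ [tau tauP]] := yP w wN; have [_ [tau' tau'P]] := yP w' w'N.
have lL : (l < L)%N by rewrite ltn_addr.
have := tauP (k * L + l)%N; have := tau'P (k * L + l)%N.
rewrite /z !concat_blocksE// !nthV// !lt_min => /andP[h1 _] /andP[h2 _].
have h3 : mdist (iter (k * L + l) T (y w)) (iter (k * L + l) T (y w')) <
    eps / 4 + eps / 4.
  by apply: close; rewrite mulSn addnC ltn_add2r.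
have := metric_triangle (nth b (W (w k)) l) (iter (k * L + l) T (y w))
  (nth b (W (w' k)) l).
have := metric_triangle (iter (k * L + l) T (y w)) (iter (k * L + l) T (y w'))
  (nth b (W (w' k)) l).
rewrite [mdist (nth b (W (w k)) l) (iter _ T _)]metric_sym.
lra.
Qed.

Lemma htop_irregular_ge (b : X) (Y : set X) :
  chain_related T b b -> irregular_set T Phi b ->
  Y `<=` [set u | chain_related T b u] ->
  (htop T Y <= htop T (irregular_set T Phi))%E.
Proof.
move=> bb irr Yb; rewrite htopE; apply: ge_ereal_sup => _ [eps eps0 <-].
have ge_eps e : 0 < e -> (htop_eps T (irregular_set T Phi) e <=
    htop T (irregular_set T Phi))%E.
  by move=> e0; rewrite htopE; apply: ereal_sup_ubound; exists e.
have h_ge0 : (0 <= htop T (irregular_set T Phi))%E.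
  by apply: le_trans (ge_eps _ ltr01); apply: htop_eps_ge0; exists b.
rewrite leNgt; apply/negP => lt_h.
suff [t [t1 [t0 tt1 ht t1h]]] : exists t t1, [/\ 0 < t, t < t1,
    (htop T (irregular_set T Phi) < t%:E)%E & (t1%:E < htop_eps T Y eps)%E].
  have := irregular_htop_eps_ge bb irr Yb eps0 t0 tt1 t1h.
  apply/negP; rewrite -ltNge; apply: le_lt_trans ht; apply: ge_eps.
  by rewrite divr_gt0.
case: (htop T _) h_ge0 lt_h => [h| |]; last by [].
  rewrite lee_fin => h0.
  case: (htop_eps T Y eps) => [h'| |]; last by [].
    rewrite lte_fin => hh'; exists (h + (h' - h) / 3), (h + (h' - h) / 3 * 2).
    by rewrite !lte_fin; split; lra.
  by move=> _; exists (h + 1), (h + 2); rewrite !lte_fin ltry; split=> //; lra.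
by move=> _; rewrite ltNge leey.
Qed.

End assembly.

Theorem corollary3p2 (R : realType) (X : metricType R) (T : X -> X)
    (X_compact : compact [set: X]) (T_continuous : continuous T)
    (T_shadowing : shadowing T)
    (Y : set X) (Y_class : chain_recurrent_class T Y)
    (Phi : X -> R) (Phi_continuous : continuous Phi)
    (IY_nonempty : irregular_set T Phi `&` Y !=set0) :
  (htop T (irregular_set T Phi) >= htop T Y)%E.
Proof.
have [a _ YE] := Y_class; have [b [irr]] := IY_nonempty.
rewrite {1}YE => -[b_rec ab].
apply: (@htop_irregular_ge _ _ _ _ X_compact _ _ _ b) => // u.
rewrite YE => -[_ au]; exact: chain_related_trans (chain_related_sym ab) au.
Qed.
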